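(* Let $b$ be a prime, $d\ge 1$, $K=\mathbb{F}_b((x^{-1}))$, $A=\mathbb{F}_b[x]$. Let $T\in\mathrm{GL}_d(K)$ and $\mathbb{X}=T(A^d)$. Consider a decomposition $T=L'Q$, where $L'=(l'_{ij})_{i,j=1}^d\in K^{d\times d}$ is lower triangular and $Q\in\mathbb{F}_b[[x^{-1}]]^{d\times d}$ with $\det Q=1$. Assume that $\boldsymbol f=(f_1,\dots,f_d)\in A^d$ satisfies $f_j\neq0$ and $\deg(f_j)\ge\max_{1\le i\le j}\deg(l'_{ji})$ for all $1\le j\le d$. Let $\mathcal{P}_{\boldsymbol f,d}=\boldsymbol f^{-1}\mathbb{X}\cap\mathbb{U}^d_b$. Then $$|\mathcal{P}_{\boldsymbol f,d}|=b^{-\deg(\det T)+\sum_{j=1}^d\deg(f_j)} .$$ Further, with $D_{\boldsymbol f}=\mathrm{diag}(f_1,\dots,f_d)$, $L=(l_{ij})_{i,j=1}^d=D_{\boldsymbol f}^{-1}L'$ and $\mathbb{S}=\{\boldsymbol g\in A^d: L\boldsymbol g\in\mathbb{U}^d_b\}$, $$\mathcal{P}_{\boldsymbol f,d}=\{LQ\,(Q^{-1}\boldsymbol g)_{\mathrm{poly}}:\boldsymbol g\in\mathbb{S}\},$$ and $\mathbb{S}=\mathbb{S}^{(d)}$ is obtained inductively from $\mathbb{S}^{(1)}=\{g\in A:\deg g<-\deg(l_{11})\}$ and, for $2\le j\le d$, $\mathbb{S}^{(j)}$ is the set of all $(g_1,\dots,g_j)\in A^j$ with $(g_1,\dots,g_{j-1})\in\mathbb{S}^{(j-1)}$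 and $$g_j=\Big(-l_{jj}^{-1}\sum_{i=1}^{j-1}l_{ji}g_i\Big)_{\mathrm{poly}}+h\quad\text{for some }h\in A\text{ with }\deg h<-\deg(l_{jj}).$$
   Context: $K=\mathbb{F}_b((x^{-1}))$ is the field of formal Laurent series $\sum_{i=w}^\infty c_ix^{-i}$ ($w\in\mathbb{Z}$, $c_i\in\mathbb{F}_b$), $A=\mathbb{F}_b[x]\subset K$. For $f=\sum_{i\ge w}c_ix^{-i}$ with $c_w\ne0$, $\deg(f)=-w$; $\deg(0)=-\infty$. $\mathbb{F}_b[[x^{-1}]]=\{f\in K:\deg f\le0\}$. $\mathbb{U}^d_b=\{(g_1,\dots,g_d)\in K^d:\deg(g_j)<0\ \forall j\}$. $\boldsymbol f^{-1}\mathbb{X}=\{(f_1^{-1}g_1,\dots,f_d^{-1}g_d):(g_1,\dots,g_d)\in\mathbb{X}\}$. Polynomial part: for $g=\sum_{i\ge w}c_ix^{-i}\in K$, $(g)_{\mathrm{poly}}=\sum_{i=w}^{0}c_ix^{-i}\in A$ if $w\le0$ and $(g)_{\mathrm{poly}}=0$ otherwise; for vectors it is applied componentwise. *)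

(* Defs.v *)
From HB Require Import structures.
From mathcomp Require Import all_boot all_order all_algebra.
From mathcomp Require Import boolp classical_sets functions cardinality fsbigop.
From mathcomp Require Import constructive_ereal.
From mathcomp Require Import zify.

Set Implicit Arguments.
Unset Strict Implicit.
Unset Printing Implicit Defensive.

Import Order.TTheory GRing.Theory Num.Theory.
Local Open Scope classical_set_scope.
Local Open Scope ring_scope.

Definition vanish_below (V : zmodType) (w : int) (c : int -> V) : Prop :=
  forall i, i < w -> c i = 0.

(* [laurent F] is F((x^-1)): the value of a series at [i : int] is its
   coefficient of x^-i. *)
Record laurent (F : fieldType) : Type := Laurent {
  lcoef :> int -> F;
  _ : `[< exists w, vanish_below w lcoef >] }.

HB.instance Definition _ (F : fieldType) := [isSub for @lcoef F].
HB.instance Definition _ (F : fieldType) := gen_eqMixin (laurent F).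
HB.instance Definition _ (F : fieldType) := gen_choiceMixin (laurent F).

Section LaurentField.
Variable F : fieldType.
Local Notation K := (laurent F).
Implicit Types (f g h : K) (a c w : int).

Lemma laurentP f g : (forall i, f i = g i) -> f = g.
Proof. by move=> E; apply/val_inj/funext. Qed.

Lemma laurent_bound f : exists w, vanish_below w f.
Proof. by case: f => s /= /asboolP. Qed.

Definition mk_laurent w (s : int -> F) (Hs : vanish_below w s) : K :=
  Laurent (asboolT (ex_intro _ w Hs)).

Lemma vanish_le w w' (s : int -> F) :
  w' <= w -> vanish_below w s -> vanish_below w' s.
Proof. by move=> le_w Hs i lt_i; apply: Hs; apply: lt_le_trans le_w. Qed.

Lemma vanish_eq w f g : vanish_below w f -> vanish_below w g ->
  (forall k : nat, f (w + k%:Z) = g (w + k%:Z)) -> f = g.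
Proof.
move=> Hf Hg E; apply: laurentP => i.
case: (ltP i w) => [lt_i|le_i]; first by rewrite Hf // Hg.
have -> : i = w + (`|i - w|%N)%:Z by lia.
exact: E.
Qed.

Lemma common_bound f g : exists w, vanish_below w f /\ vanish_below w g.
Proof.
have [a Ha] := laurent_bound f; have [c Hc] := laurent_bound g.
by exists (Num.min a c); split; [apply: vanish_le Ha|apply: vanish_le Hc];
  rewrite ge_min lexx ?orbT.
Qed.

Fact lzero_subproof : vanish_below 0 (fun _ : int => 0 : F).
Proof. by []. Qed.
Definition lzero : K := mk_laurent lzero_subproof.

Fact lopp_subproof f : `[< exists w, vanish_below w (fun i => - f i) >].
Proof.
have [w Hw] := laurent_bound f.
by apply/asboolP; exists w => i /Hw ->; rewrite oppr0.
Qed.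
Definition lopp f : K := Laurent (lopp_subproof f).

Fact ladd_subproof f g : `[< exists w, vanish_below w (fun i => f i + g i) >].
Proof.
have [w [Hf Hg]] := common_bound f g.
by apply/asboolP; exists w => i lt_i; rewrite Hf // Hg // addr0.
Qed.
Definition ladd f g : K := Laurent (ladd_subproof f g).

Fact laddA : associative ladd.
Proof. by move=> f g h; apply: laurentP => i /=; rewrite addrA. Qed.
Fact laddC : commutative ladd.
Proof. by move=> f g; apply: laurentP => i /=; rewrite addrC. Qed.
Fact ladd0 : left_id lzero ladd.
Proof. by move=> f; apply: laurentP => i /=; rewrite add0r. Qed.
Fact laddN : left_inverse lzero lopp ladd.
Proof. by move=> f; apply: laurentP => i /=; rewrite addNr. Qed.

HB.instance Definition _ := GRing.isZmodule.Build K laddA laddC ladd0 laddN.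

Lemma lcoef0 i : (0 : K) i = 0. Proof. by []. Qed.
Lemma lcoefD f g i : (f + g) i = f i + g i. Proof. by []. Qed.
Lemma lcoefN f i : (- f) i = - f i. Proof. by []. Qed.

(* Only finitely many terms are nonzero, and [\sum_(i \in _)] is the sum over
   the (finite) support. *)
Definition lconv (s t : int -> F) (n : int) : F :=
  \sum_(i \in [set: int]) s i * t (n - i).

Lemma lconv_seq (s t : int -> F) n (r : seq int) : uniq r ->
  (forall i, i \notin r -> s i * t (n - i) = 0) ->
  lconv s t n = \sum_(i <- r) s i * t (n - i).
Proof.
move=> Ur H0; rewrite fsbig_seq // /lconv; apply/esym; apply: fsbig_widen => //.
by move=> i [_ /= /negP]; apply: H0.
Qed.

Lemma lconv_vanish (s t : int -> F) a c :
  vanish_below a s -> vanish_below c t -> vanish_below (a + c) (lconv s t).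
Proof.
move=> Hs Ht n lt_n; rewrite (@lconv_seq _ _ _ [::]) ?big_nil // => i _.
case: (ltP i a) => [/Hs ->|le_i]; first by rewrite mul0r.
by rewrite Ht ?mulr0 //; lia.
Qed.

Definition trunc a N (s : int -> F) : {poly F} := \poly_(i < N) s (a + i%:Z).

Lemma lconvE (s t : int -> F) a c N k :
  vanish_below a s -> vanish_below c t -> (k < N)%N ->
  lconv s t (a + c + k%:Z) = (trunc a N s * trunc c N t)`_k.
Proof.
move=> Hs Ht lt_k.
rewrite (@lconv_seq _ _ _ [seq a + (i : nat)%:Z | i <- iota 0 k.+1]); first last.
- move=> i ni; case: (ltP i a) => [/Hs ->|le_i]; first by rewrite mul0r.
  case: (leqP `|i - a|%N k) => [le_k|lt_ki]; last by rewrite Ht ?mulr0 //; lia.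
  case/mapP: ni; exists `|i - a|%N; last by lia.
  by rewrite mem_iota; lia.
- by rewrite map_inj_uniq ?iota_uniq // => x y; lia.
rewrite big_map coefM -{1}[k.+1]subn0 -/(index_iota 0 k.+1) big_mkord.
apply: eq_bigr => i _; rewrite !coef_poly.
have -> : (i < N)%N by have := ltn_ord i; lia.
have -> : (k - i < N)%N by lia.
by congr (_ * t _); have := ltn_ord i; lia.
Qed.

Fact lmul_subproof f g : `[< exists w, vanish_below w (lconv f g) >].
Proof.
have [a Ha] := laurent_bound f; have [c Hc] := laurent_bound g.
by apply/asboolP; exists (a + c); apply: lconv_vanish.
Qed.
Definition lmul f g : K := Laurent (lmul_subproof f g).

Fact lone_subproof : vanish_below 0 (fun i : int => (i == 0)%:R : F).
Proof. by move=> i lt_i; rewrite lt_eqF. Qed.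
Definition lone : K := mk_laurent lone_subproof.

Lemma lmul_vanish a c f g :
  vanish_below a f -> vanish_below c g -> vanish_below (a + c) (lmul f g).
Proof. exact: lconv_vanish. Qed.

Lemma lmulE f g a c N k : vanish_below a f -> vanish_below c g ->
  (k < N)%N -> lmul f g (a + c + k%:Z) = (trunc a N f * trunc c N g)`_k.
Proof. exact: lconvE. Qed.

Lemma trunc_lmul f g a c N k : vanish_below a f -> vanish_below c g ->
  (k < N)%N -> (trunc (a + c) N (lmul f g))`_k = (trunc a N f * trunc c N g)`_k.
Proof. by move=> Hf Hg lt_k; rewrite coef_poly lt_k; apply: lmulE. Qed.

Fact lmulC : commutative lmul.
Proof.
move=> f g; have [a Ha] := laurent_bound f; have [c Hc] := laurent_bound g.
apply: (@vanish_eq (a + c)); first exact: lmul_vanish.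
  by rewrite addrC; apply: lmul_vanish.
move=> k; rewrite (lmulE Ha Hc (ltnSn k)) mulrC -(lmulE Hc Ha (ltnSn k)).
by rewrite (addrC a).
Qed.

Fact lmulA : associative lmul.
Proof.
move=> f g h; have [a Ha] := laurent_bound f; have [c Hc] := laurent_bound g.
have [e He] := laurent_bound h.
have Hfg := lmul_vanish Ha Hc; have Hgh := lmul_vanish Hc He.
apply: (@vanish_eq (a + (c + e))); first exact: lmul_vanish.
  by rewrite addrA; apply: lmul_vanish.
move=> k; rewrite (lmulE Ha Hgh (ltnSn k)) addrA (lmulE Hfg He (ltnSn k)).
transitivity (trunc a k.+1 f * (trunc c k.+1 g * trunc e k.+1 h))`_k.
  rewrite coefM [RHS]coefM; apply: eq_bigr => i _.
  by rewrite trunc_lmul //; lia.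
rewrite mulrA coefM [RHS]coefM; apply: eq_bigr => i _.
by rewrite trunc_lmul.
Qed.

Fact lmul1 : left_id lone lmul.
Proof.
move=> f; have [c Hc] := laurent_bound f.
have H1 : vanish_below 0 lone by exact: lone_subproof.
apply: (@vanish_eq (0 + c)); first exact: lmul_vanish.
  by rewrite add0r.
move=> k; rewrite (lmulE H1 Hc (ltnSn k)).
have -> : trunc 0 k.+1 lone = 1.
  by apply/polyP => -[|i]; rewrite coef_poly coef1 //= if_same.
by rewrite mul1r coef_poly ltnSn add0r.
Qed.

Fact lmulDl : left_distributive lmul ladd.
Proof.
move=> f g h; have [a [Hf Hg]] := common_bound f g.
have [c Hc] := laurent_bound h.
have Hfg : vanish_below a (ladd f g).
  by move=> i lt_i /=; rewrite Hf // Hg // addr0.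
apply: (@vanish_eq (a + c)); first exact: lmul_vanish.
  by move=> i lt_i /=; rewrite !(lconv_vanish (a := a) (c := c)) // addr0.
move=> k; rewrite [RHS]/= -/(lmul f h) -/(lmul g h).
rewrite -[lconv f h _]/(lmul f h _) -[lconv g h _]/(lmul g h _).
rewrite (lmulE Hfg Hc (ltnSn k)) (lmulE Hf Hc (ltnSn k)) (lmulE Hg Hc (ltnSn k)).
rewrite -coefD -mulrDl; congr ((_ * _) : {poly F})`_k; apply/polyP => i.
by rewrite coefD !coef_poly; case: ifP; rewrite ?addr0.
Qed.

Fact lone_neq0 : lone != 0.
Proof.
apply/eqP => /(congr1 (fun f : K => f 0)) /eqP.
by rewrite /= oner_eq0.
Qed.

HB.instance Definition _ :=
  GRing.Zmodule_isComNzRing.Build K lmulA lmulC lmul1 lmulDl lone_neq0.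

Lemma lcoef1 i : (1 : K) i = (i == 0)%:R. Proof. by []. Qed.
Lemma lcoefM f g i : (f * g) i = \sum_(j \in [set: int]) f j * g (i - j).
Proof. by []. Qed.

Definition lorder f : int :=
  xget 0 [set w | f w != 0 /\ vanish_below w f].

Lemma lorderP f : f != 0 -> f (lorder f) != 0 /\ vanish_below (lorder f) f.
Proof.
move=> f_neq0; suff ex_w : exists w, f w != 0 /\ vanish_below w f.
  exact: (@xgetPex _ 0 [set w | f w != 0 /\ vanish_below w f]).
have [w Hw] := laurent_bound f.
have ex_k : exists k : nat, f (w + k%:Z) != 0.
  apply: contrapT => nex; case/eqP: f_neq0; apply: (@vanish_eq w) => // k.
  by apply/eqP; apply: contrapT => /negP fk; apply: nex; exists k.
case: (ex_minnP ex_k) => k fk min_k; exists (w + k%:Z); split=> // i lt_i.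
case: (ltP i w) => [/Hw //|le_i]; apply/eqP; apply: contrapT => /negP fi.
have := min_k `|i - w|%N; have -> : w + (`|i - w|%N)%:Z = i by lia.
by move=> /(_ fi); lia.
Qed.

Fixpoint inv_prefix (u : nat -> F) (n : nat) : seq F :=
  if n is m.+1 then
    let s := inv_prefix u m in
    rcons s ((u 0%N)^-1 * ((m == 0%N)%:R - \sum_(i < m) u (m - i)%N * s`_i))
  else [::].

Definition inv_coef u n := (inv_prefix u n.+1)`_n.

Lemma size_inv_prefix u n : size (inv_prefix u n) = n.
Proof. by elim: n => //= n IHn; rewrite size_rcons IHn. Qed.

Lemma nth_inv_prefix u n i : (i < n)%N -> (inv_prefix u n)`_i = inv_coef u i.
Proof.
elim: n => // n IHn; rewrite ltnS leq_eqVlt => /predU1P[->//|lt_i].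
by rewrite /= nth_rcons size_inv_prefix lt_i IHn.
Qed.

Lemma inv_coefP u n : u 0%N != 0 ->
  \sum_(i < n.+1) u (n - i)%N * inv_coef u i = (n == 0%N)%:R.
Proof.
move=> u0; rewrite big_ord_recr /= subnn {2}/inv_coef /= nth_rcons.
rewrite size_inv_prefix ltnn eqxx mulVKf //.
have -> : \sum_(i < n) u (n - i)%N * (inv_prefix u n)`_i =
          \sum_(i < n) u (n - i)%N * inv_coef u i.
  by apply: eq_bigr => i _; rewrite nth_inv_prefix.
by rewrite addrC subrK.
Qed.

Lemma laurent_inv_ex f : f != 0 -> exists g, g * f = 1.
Proof.
move=> /lorderP [fw Hf]; set w := lorder f in fw Hf.
pose u (k : nat) := f (w + k%:Z).
have u0 : u 0%N != 0 by rewrite /u addr0.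
pose s (i : int) : F := if i < - w then 0 else inv_coef u `|(i + w)%R|%N.
have Hs : vanish_below (- w) s by move=> i lt_i; rewrite /s lt_i.
pose g := mk_laurent Hs; exists g; rewrite mulrC.
have Hg : vanish_below (- w) g by exact: Hs.
apply: (@vanish_eq (w + - w)); first exact: lmul_vanish.
  by rewrite subrr; exact: lone_subproof.
move=> k; rewrite -[f * g]/(lmul f g) (lmulE Hf Hg (ltnSn k)).
rewrite coefMr subrr add0r lcoef1 -[_ == 0]/(k == 0%N) -(inv_coefP k u0).
apply: eq_bigr => i _; rewrite !coef_poly ltn_ord.
have -> : (k - i < k.+1)%N by lia.
rewrite /= {1}/s.
have -> : (- w + i%:Z < - w) = false by lia.
by congr (_ * inv_coef u _); lia.
Qed.

Definition linv f : K := xget 0 [set g | g * f = 1].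

Fact lmulVf f : f != 0 -> linv f * f = 1.
Proof. by move=> /laurent_inv_ex; apply: (@xgetPex _ 0 [set g | g * f = 1]). Qed.

Fact linv0 : linv 0 = 0.
Proof.
by apply: xgetPN => g /= /eqP; rewrite mulr0 eq_sym oner_eq0.
Qed.

HB.instance Definition _ := GRing.ComNzRing_isField.Build K lmulVf linv0.

(* Degrees live in Z extended with -oo and +oo, so that deg 0 = -oo. *)
Definition deg f : \bar int := if f == 0 then -oo%E else ((- lorder f)%:E)%E.

Fact laurent_of_poly_subproof (p : {poly F}) :
  vanish_below (- (size p)%:Z) (fun i : int => if i <= 0 then p`_`|i|%N else 0).
Proof.
move=> i; move Dm: (size p) => m lt_i; case: ifP => // _.
by rewrite nth_default // Dm; lia.
Qed.

(* The inclusion F[x] -> F((x^-1)). *)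
Definition laurent_of_poly p : K := mk_laurent (@laurent_of_poly_subproof p).

Definition poly_part f : {poly F} := \poly_(i < `|lorder f|.+1) f (- i%:Z).

Lemma coef_poly_part f i : (poly_part f)`_i = f (- i%:Z).
Proof.
rewrite coef_poly; case: ifP => // ge_i.
have [->//|/lorderP [_ Hf]] := eqVneq f 0.
by rewrite Hf //; lia.
Qed.

Lemma laurent_of_polyK : cancel laurent_of_poly poly_part.
Proof.
move=> p; apply/polyP => i; rewrite coef_poly_part /=.
by rewrite oppr_le0 lez_nat leq0n abszN.
Qed.

Fact laurent_of_poly_is_additive : zmod_morphism laurent_of_poly.
Proof.
move=> p q; apply: laurentP => i /=.
by case: ifP => _; rewrite ?coefB ?subr0.
Qed.
HB.instance Definition _ := GRing.isZmodMorphism.Build {poly F} K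
  laurent_of_poly laurent_of_poly_is_additive.

Fact laurent_of_poly_is_monoid_morphism : monoid_morphism laurent_of_poly.
Proof.
split=> [|p q]; apply: laurentP => n.
  by rewrite /= coef1 absz_eq0; case: ifP => // /negbT; case: eqP => // ->.
rewrite [LHS]/=; case: ifP => [le_n|gt_n]; last first.
  rewrite [RHS](@lconv_seq _ _ _ [::]) ?big_nil // => i _ /=.
  case: (leP i 0) => le_i; last by rewrite mul0r.
  have -> : (n - i <= 0) = false by lia.
  by rewrite mulr0.
rewrite [RHS](@lconv_seq _ _ _ [seq - (i : nat)%:Z | i <- iota 0 `|n|.+1]); first last.
- move=> i ni /=; case: (leP i 0) => le_i; last by rewrite mul0r.
  case: (leP (n - i) 0) => le_ni; last by rewrite mulr0.
  by case/mapP: ni; exists `|i|%N; rewrite ?mem_iota; lia.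
- by rewrite map_inj_uniq ?iota_uniq // => x y; lia.
rewrite big_map coefM (_ : iota 0 _ = index_iota 0 `|n|.+1); last first.
  by rewrite /index_iota subn0.
rewrite big_mkord.
apply: eq_bigr => i _ /=; have := ltn_ord i => lt_i.
have -> : - (i : nat)%:Z <= 0 by lia.
have -> : n - - (i : nat)%:Z <= 0 by lia.
by congr (p`_ _ * q`_ _); lia.
Qed.
HB.instance Definition _ := GRing.isMonoidMorphism.Build {poly F} K
  laurent_of_poly laurent_of_poly_is_monoid_morphism.

Local Notation "p %:L" := (laurent_of_poly p) (at level 1, format "p %:L").
Local Notation vecL := (map_mx laurent_of_poly).

Definition unit_box (d : nat) : set 'cV[K]_d :=
  [set g | forall j, (deg (g j ord0) < 0)%E].

Definition lattice (d : nat) (T : 'M[K]_d) : set 'cV[K]_d :=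
  [set T *m vecL g | g in [set: 'cV[{poly F}]_d]].

Definition inv_scale (d : nat) (f : 'rV[{poly F}]_d) (X : set 'cV[K]_d) :
    set 'cV[K]_d :=
  [set \col_j ((f ord0 j)%:L^-1 * g j ord0) | g in X].

Definition net (d : nat) (f : 'rV[{poly F}]_d) (T : 'M[K]_d) : set 'cV[K]_d :=
  inv_scale f (lattice T) `&` @unit_box d.

Definition net_index (d : nat) (L : 'M[K]_d) : set 'cV[{poly F}]_d :=
  [set g | unit_box (L *m vecL g)].

(* [ind_index L m] is the set S^(m+1); indices start at 0, so l_11 is
   [L ord0 ord0] and the pivot of the step to S^(m+2) is [L m.+1 m.+1].  Only the
   values m <= n are meaningful. *)
Fixpoint ind_index (n : nat) (L : 'M[K]_n.+1) (m : nat) :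
    set 'cV[{poly F}]_m.+1 :=
  match m with
  | 0%N => [set g | (deg (g ord0 ord0)%:L < - deg (L ord0 ord0))%E]
  | m'.+1 => [set g |
      ind_index L (\col_(i < m'.+1) g (widen_ord (leqnSn m'.+1) i) ord0) /\
      exists2 h : {poly F},
        (deg h%:L < - deg (L (inord m'.+1) (inord m'.+1)))%E &
        g ord_max ord0 =
          poly_part (- (L (inord m'.+1) (inord m'.+1))^-1 *
            \sum_(i < m'.+1)
              L (inord m'.+1) (inord i) *
                (g (widen_ord (leqnSn m'.+1) i) ord0)%:L) + h]
  end.

End LaurentField.

Arguments unit_box {F} d.
Arguments ind_index {F n} L m.

Notation "p %:L" := (laurent_of_poly p) (at level 1, format "p %:L") : ring_scope.
Notation vecL := (map_mx (@laurent_of_poly _)).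

(* Main.v *)
Require Import Defs.
From mathcomp Require Import all_boot all_order all_algebra.
From mathcomp Require Import finmap.
From mathcomp Require Import boolp classical_sets functions cardinality fsbigop.
From mathcomp Require Import constructive_ereal.
From mathcomp Require Import zify.

Import Order.TTheory GRing.Theory Num.Theory.
Local Open Scope classical_set_scope.
Local Open Scope ring_scope.

(* Put L = D^-1 L'.  The degree condition on f makes L integral (entries of
   degree <= 0), and so are Q and, since det Q = 1, its adjugate Q^-1.  Integral
   matrices preserve the unit box, so replacing a vector by its polynomial part
   does not affect whether its image under L lies in the box.  Hence
   g |-> poly(Q^-1 g) and h |-> poly(Q h) are inverse bijections between S and
   the polynomial vectors h with L Q h in the box, i.e. the points of P.  Since L
   is triangular, S is found by forward substitution: once g_1, ..., g_(j-1) are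
   chosen there are b^(- deg l_jj) choices of g_j, and these exponents add up to
   deg f_1 + ... + deg f_d - deg (det T). *)

Set Implicit Arguments.
Unset Strict Implicit.

(** * Orders and degrees of Laurent series *)

Section LaurentDegree.
Context {F : fieldType}.
Local Notation K := (laurent F).
Implicit Types (f g : K) (p : {poly F}) (a c w : int).

(** Index [i] carries the coefficient of x^-i, so degree at least [c] means index at most [- c];
    hence the bound [1 - c]. In this form estimates need no separate case for the zero series. *)
Lemma deg_lt f c : (deg f < c%:E)%E <-> vanish_below (1 - c) f.
Proof.
rewrite /deg; have [->|f0] := eqVneq f 0; first by rewrite ltNyr.
have [fw vf] := lorderP f0; rewrite lte_fin; split=> [lt_c i lt_i|vf'].
  by apply: vf; lia.
rewrite ltNge; apply/negP => le_c; case/eqP: fw; apply: vf'; lia.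
Qed.

Lemma deg_le f c : (deg f <= c%:E)%E <-> vanish_below (- c) f.
Proof.
suff -> : (deg f <= c%:E)%E = (deg f < (c + 1)%:E)%E.
  by rewrite deg_lt opprD addrCA subrr addr0.
rewrite /deg; case: eqP => _; first by rewrite ltNyr leNye.
by rewrite lee_fin lte_fin; lia.
Qed.

Lemma deg_neq0 f : f != 0 -> deg f = (- lorder f)%:E.
Proof. by rewrite /deg => /negPf ->. Qed.

Lemma vanish1 : vanish_below 0 (1 : K).
Proof. exact: lone_subproof. Qed.

Lemma vanishD w f g :
  vanish_below w f -> vanish_below w g -> vanish_below w (f + g).
Proof. by move=> vf vg i lt_i; rewrite lcoefD vf ?vg ?addr0. Qed.

Lemma vanishN w f : vanish_below w f -> vanish_below w (- f).
Proof. by move=> vf i lt_i; rewrite lcoefN vf ?oppr0. Qed.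

Lemma vanishB w f g :
  vanish_below w f -> vanish_below w g -> vanish_below w (f - g).
Proof. by move=> vf vg; apply: vanishD => //; apply: vanishN. Qed.

Lemma vanishM a c f g :
  vanish_below a f -> vanish_below c g -> vanish_below (a + c) (f * g).
Proof. exact: lmul_vanish. Qed.

Lemma vanishMl w f g :
  vanish_below 0 f -> vanish_below w g -> vanish_below w (f * g).
Proof. by rewrite -{2}[w]add0r; apply: vanishM. Qed.

Lemma vanish_sum (I : Type) (r : seq I) (P : pred I) (G : I -> K) w :
  (forall i, P i -> vanish_below w (G i)) ->
  vanish_below w (\sum_(i <- r | P i) G i).
Proof.
by move=> vG; apply: (big_ind (fun x : K => vanish_below w x)) => //; apply: vanishD.
Qed.

Lemma vanish_prod (I : Type) (r : seq I) (P : pred I) (G : I -> K) :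
  (forall i, P i -> vanish_below 0 (G i)) ->
  vanish_below 0 (\prod_(i <- r | P i) G i).
Proof.
move=> vG; apply: (big_ind (fun x : K => vanish_below 0 x)) => //; first exact: vanish1.
by move=> x y; apply: vanishMl.
Qed.

Lemma vanish_sign n : vanish_below 0 ((-1) ^+ n : K).
Proof.
rewrite -signr_odd; case: odd; first exact/vanishN/vanish1.
exact: vanish1.
Qed.

Lemma lorder_eq f w : f w != 0 -> vanish_below w f -> lorder f = w.
Proof.
move=> fw vf; have f0 : f != 0 by apply: contraNneq fw => ->.
have [fl vl] := lorderP f0.
apply: le_anti; rewrite !leNgt; apply/andP; split; apply/negP.
  by move=> /vl /eqP; apply/negP.
by move=> /vf /eqP; apply/negP.
Qed.

(** The lowest coefficient of the product is the product of the lowest coefficients, read off from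
    windows of length 1. *)
Lemma lorderM f g : f != 0 -> g != 0 -> lorder (f * g) = lorder f + lorder g.
Proof.
move=> /lorderP[fa va] /lorderP[gc vc].
apply: lorder_eq; last exact: vanishM.
rewrite -[_ + _]addr0 -[f * g]/(lmul f g) (lmulE (N := 1) (k := 0) va vc) //.
by rewrite coef0M !coef_poly /= !addr0 mulf_neq0.
Qed.

Lemma lorder1 : lorder (1 : K) = 0.
Proof. by apply: lorder_eq; [rewrite lcoef1 oner_eq0|exact: vanish1]. Qed.

Lemma lorderV f : f != 0 -> lorder f^-1 = - lorder f.
Proof.
move=> f0; have fV0 : f^-1 != 0 by rewrite invr_eq0.
apply/eqP; rewrite -addr_eq0; have <- := lorderM fV0 f0.
by rewrite mulVf ?lorder1.
Qed.

Lemma lorder_prod (I : Type) (r : seq I) (G : I -> K) :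
  (forall i, G i != 0) ->
  lorder (\prod_(i <- r) G i) = \sum_(i <- r) lorder (G i).
Proof.
move=> G0; elim: r => [|x r IHr]; first by rewrite !big_nil lorder1.
rewrite !big_cons lorderM ?IHr //.
by elim/big_ind: _ => //; [exact: oner_neq0 | exact: mulf_neq0].
Qed.

Lemma vanish_mulr w f g : g != 0 ->
  vanish_below (w + lorder g) (f * g) <-> vanish_below w f.
Proof.
move=> g0; have [_ vg] := lorderP g0; split=> [vfg|vf]; last exact: vanishM.
have /lorderP[_ vg'] : g^-1 != 0 by rewrite invr_eq0.
by have := vanishM vfg vg'; rewrite mulfK // lorderV // addrK.
Qed.

(** * Polynomials inside K and polynomial parts *)

Lemma laurent_of_poly_eq0 p : (p%:L == 0) = (p == 0).
Proof. exact: raddf_eq0 (can_inj (@laurent_of_polyK F)). Qed.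

Lemma vanish_poly p (k : nat) :
  vanish_below (1 - k%:Z) p%:L <-> (size p <= k)%N.
Proof.
split=> [vp|le_k i lt_i].
  apply/leq_sizeP => i le_i.
  have := vp (- i%:Z); rewrite /= oppr_le0 lez_nat leq0n abszN; apply; lia.
by rewrite /=; case: ifP => // _; rewrite nth_default //; apply: leq_trans le_k _; lia.
Qed.

Lemma vanish_frac f : vanish_below 1 (f - (poly_part f)%:L).
Proof.
move=> i lt_i; rewrite lcoefD lcoefN /= coef_poly_part.
have le_i : i <= 0 by lia.
by rewrite le_i (_ : - _ = i) ?subrr //; lia.
Qed.

(** A series of negative degree has no coefficient at indices [i <= 0], where all coefficients of a
    polynomial sit. *)
Lemma poly_partE p f : vanish_below 1 (f - p%:L) -> poly_part f = p.
Proof.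
move=> v; apply/polyP => i; rewrite coef_poly_part; apply/eqP.
have := v (- i%:Z); rewrite lcoefD lcoefN /= oppr_le0 lez_nat leq0n abszN.
by move=> H; rewrite -subr_eq0 H //; lia.
Qed.

Lemma poly_part0 : poly_part (0 : K) = 0.
Proof. by apply: poly_partE; rewrite rmorph0 subr0. Qed.

(** * The unit box and integral matrices *)

Lemma unit_boxP d (g : 'cV[K]_d) :
  unit_box d g <-> forall j, vanish_below 1 (g j ord0).
Proof. by split=> H j; have := H j; rewrite deg_lt subr0. Qed.

Lemma unit_boxB d (g h : 'cV[K]_d) :
  unit_box d g -> unit_box d h -> unit_box d (g - h).
Proof.
move=> /unit_boxP vg /unit_boxP vh; apply/unit_boxP => j.
by rewrite !mxE; apply: vanishB.
Qed.

Definition integral_mx m d (M : 'M[K]_(m, d)) :=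
  forall i j, vanish_below 0 (M i j).

Lemma unit_box_mulmx m d (M : 'M[K]_(m, d)) (u : 'cV[K]_d) :
  integral_mx M -> unit_box d u -> unit_box m (M *m u).
Proof.
move=> vM /unit_boxP vu; apply/unit_boxP => j; rewrite mxE.
by apply: vanish_sum => i _; apply: vanishMl.
Qed.

Lemma integral_det d (M : 'M[K]_d) : integral_mx M -> vanish_below 0 (\det M).
Proof.
move=> vM; apply: vanish_sum => s _; apply: vanishMl; first exact: vanish_sign.
by apply: vanish_prod => i _; apply: vM.
Qed.

(** For determinant 1 the inverse is the adjugate, whose entries are signed minors of [M]. *)
Lemma integral_invmx d (M : 'M[K]_d) :
  integral_mx M -> \det M = 1 -> integral_mx (invmx M).
Proof.
move=> vM dM i j; rewrite /invmx unitmxE dM unitr1 invr1 scale1r mxE.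
apply: vanishMl; first exact: vanish_sign.
by apply: integral_det => k l; rewrite !mxE; apply: vM.
Qed.

Local Notation poly_mx := (map_mx (@poly_part F)).

Lemma unit_box_frac d (v : 'cV[K]_d) : unit_box d (v - vecL (poly_mx v)).
Proof. by apply/unit_boxP => j; rewrite !mxE; apply: vanish_frac. Qed.

Lemma poly_mxE d (v : 'cV[K]_d) (h : 'cV[{poly F}]_d) :
  unit_box d (v - vecL h) -> poly_mx v = h.
Proof.
move=> /unit_boxP vh; apply/matrixP => i j; rewrite (ord1 j) mxE.
by apply: poly_partE; have := vh i; rewrite !mxE.
Qed.

(* Rounding Q^-1 g is undone by rounding Q h: for integral Q the fractional part
   u of Q^-1 g contributes Q u, which stays in the unit box. *)
Lemma poly_mx_invmxK d (Q : 'M[K]_d) (g : 'cV[{poly F}]_d) :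
  Q \in unitmx -> integral_mx Q ->
  poly_mx (Q *m vecL (poly_mx (invmx Q *m vecL g))) = g.
Proof.
move=> uQ vQ; apply: poly_mxE; set h := poly_mx _.
have -> : Q *m vecL h - vecL g = - Q *m (invmx Q *m vecL g - vecL h).
  by rewrite mulmxBr !mulNmx mulKVmx // opprK addrC.
apply: unit_box_mulmx; last exact: unit_box_frac.
by move=> i j; rewrite mxE; apply/vanishN/vQ.
Qed.

Lemma poly_mx_mulmxK d (Q : 'M[K]_d) (h : 'cV[{poly F}]_d) :
  Q \in unitmx -> integral_mx (invmx Q) ->
  poly_mx (invmx Q *m vecL (poly_mx (Q *m vecL h))) = h.
Proof.
move=> uQ vQ; rewrite -{2}(invmxK Q).
by apply: poly_mx_invmxK; rewrite ?unitmx_inv.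
Qed.

(** The two vectors tested for the box differ by [L] applied to the fractional part of
    [Q *m vecL h], and integrality of [L] keeps this difference in the box. *)
Lemma net_index_poly_mx d (L Q : 'M[K]_d) (h : 'cV[{poly F}]_d) :
  integral_mx L -> net_index L (poly_mx (Q *m vecL h)) <->
  unit_box d (L *m Q *m vecL h).
Proof.
move=> vL; rewrite /net_index /=; set g := poly_mx _.
have vu : unit_box d (L *m (Q *m vecL h - vecL g)).
  by apply: unit_box_mulmx => //; apply: unit_box_frac.
have -> : L *m Q *m vecL h = L *m vecL g + L *m (Q *m vecL h - vecL g).
  by rewrite -mulmxDr addrC subrK mulmxA.
split=> [vg|vgu]; last by have := unit_boxB vgu vu; rewrite addrK.
rewrite -[L *m (_ - _)]opprK; apply: unit_boxB => //.
by rewrite -[- _]sub0r; apply: unit_boxB => //; apply/unit_boxP => j; rewrite mxE.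
Qed.

(** * The net as an image of the index set *)

Lemma invmx_diag_vecL m d (f : 'rV[{poly F}]_d) (M : 'M[K]_(d, m)) :
  (forall j, f ord0 j != 0) ->
  invmx (diag_mx (vecL f)) *m M = \matrix_(i, j) ((f ord0 i)%:L^-1 * M i j).
Proof.
move=> f0; have uD : diag_mx (vecL f) \in unitmx.
  rewrite unitmxE det_diag unitfE; apply/prodf_neq0 => j _; rewrite mxE.
  by rewrite laurent_of_poly_eq0.
apply: (can_inj (mulKmx uD)); rewrite mulKVmx //; apply/matrixP => i j.
by rewrite mul_diag_mx !mxE mulrA mulfV ?mul1r // laurent_of_poly_eq0.
Qed.

Lemma netE d (f : 'rV[{poly F}]_d) (T : 'M[K]_d) :
  (forall j, f ord0 j != 0) ->
  net f T = [set v | exists2 h, v = invmx (diag_mx (vecL f)) *m T *m vecL h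
                      & unit_box d v].
Proof.
move=> f0.
have sc (v : 'cV_d) :
    \col_j ((f ord0 j)%:L^-1 * v j ord0) = invmx (diag_mx (vecL f)) *m v.
  by rewrite invmx_diag_vecL //; apply/colP => j; rewrite !mxE.
apply/seteqP; split=> v.
  case=> -[_ [h _ <-] <-] vb; exists h => //.
  by rewrite sc mulmxA.
case=> h -> vb; split=> //; exists (T *m vecL h); first by exists h.
by rewrite sc mulmxA.
Qed.

Lemma net_image d (f : 'rV[{poly F}]_d) (L Q T : 'M[K]_d) :
  (forall j, f ord0 j != 0) -> invmx (diag_mx (vecL f)) *m T = L *m Q ->
  integral_mx L -> integral_mx Q -> \det Q = 1 ->
  net f T = [set L *m Q *m vecL (poly_mx (invmx Q *m vecL g))
              | g in net_index L].
Proof.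
move=> f0 TE vL vQ dQ; have uQ : Q \in unitmx by rewrite unitmxE dQ unitr1.
rewrite netE // TE; apply/seteqP; split=> v.
  case=> h -> vb.
  (* Rounding [Q *m vecL h] gives the index of the point; [h] comes back by rounding the image of
     that index under [invmx Q]. *)
  exists (poly_mx (Q *m vecL h)); first exact: (net_index_poly_mx Q h vL).2 vb.
  by rewrite poly_mx_mulmxK //; apply: integral_invmx.
case=> g Sg <-; eexists; first by [].
by apply: (net_index_poly_mx Q _ vL).1; rewrite poly_mx_invmxK.
Qed.

(** Applying [invmx L] and rounding is a left inverse. It works on all polynomial vectors, so the
    count of the index set carries over to the net. *)
Lemma net_image_inj d (L Q : 'M[K]_d) :
  L \in unitmx -> Q \in unitmx -> integral_mx Q ->
  injective (fun g : 'cV[{poly F}]_d =>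
    L *m Q *m vecL (poly_mx (invmx Q *m vecL g))).
Proof.
move=> uL uQ vQ.
have LQK (v : 'cV_d) : poly_mx (invmx L *m (L *m Q *m v)) = poly_mx (Q *m v).
  by rewrite -mulmxA mulKmx.
apply: (can_inj (g := fun v => poly_mx (invmx L *m v))) => g.
by rewrite LQK; apply: poly_mx_invmxK.
Qed.

(** * Forward substitution in a triangular system *)

Lemma pivot_step (l s : K) p : l != 0 -> 0 <= lorder l ->
  vanish_below 1 (s + l * p%:L) <->
  exists2 h : {poly F}, (deg h%:L < - deg l)%E &
    p = poly_part (- l^-1 * s) + h.
Proof.
(* [y] solves [s + l * y = 0] exactly, so the condition bounds the degree of [p%:L - y] by that of
   [l^-1]. As [l] has degree at most 0, the fractional part of [y] meets this bound by itself, and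
   [y] may be rounded. *)
move=> l0 le_l; set y := - l^-1 * s.
have -> : s + l * p%:L = (p%:L - y) * l.
  by rewrite mulrBl mulrC {}/y mulrAC mulNr mulVf // mulN1r opprK addrC.
have {1}-> : 1 = (1 - lorder l) + lorder l by rewrite subrK.
rewrite vanish_mulr // (deg_neq0 l0) -EFinN opprK.
have vy : vanish_below (1 - lorder l) (y - (poly_part y)%:L).
  by apply: vanish_le (vanish_frac y); lia.
have E : p%:L - y = (p - poly_part y)%:L - (y - (poly_part y)%:L).
  by rewrite rmorphB opprB addrA subrK.
rewrite {}E; split=> [v|[h /deg_lt v ->]].
  exists (p - poly_part y); last by rewrite addrC subrK.
  apply/deg_lt; rewrite -[_%:L](subrK (y - (poly_part y)%:L)).
  exact: vanishD.
by rewrite addrAC subrr add0r; apply: vanishB.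
Qed.

(** By triangularity the first [m.+1] rows involve only the first [m.+1] unknowns, so each induction
    step adds one condition, on the last unknown, which [pivot_step] solves. [inord] embeds the
    indices faithfully because [m <= n]. *)
Lemma ind_indexE n (L : 'M[K]_n.+1) m :
  is_trig_mx L -> (forall i, L i i != 0 /\ 0 <= lorder (L i i)) ->
  (m <= n)%N ->
  ind_index L m = [set g | forall j : 'I_m.+1, vanish_below 1
    (\sum_(i < m.+1) L (inord j) (inord i) * (g i ord0)%:L)].
Proof.
move=> /is_trig_mxP trL dL; have step j := pivot_step _ _ (dL j).1 (dL j).2.
elim: m => [_|m IHm lt_m].
  apply/seteqP; split=> g /=.
    rewrite (_ : ord0 = inord 0 :> 'I_n.+1); last by apply/val_inj; rewrite /= inordK.
    (* The base set has no shift: this is [pivot_step] with [s = 0], whose polynomial part is 0. *)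
    move=> lt_g j; rewrite big_ord1 (ord1 j) -[_ * _]add0r; apply/step.
    by exists (g ord0 ord0); rewrite // mulr0 poly_part0 add0r.
  move/(_ ord0); rewrite big_ord1 -[_ * _]add0r => /step[h lt_h].
  rewrite mulr0 poly_part0 add0r => ->.
  by move: lt_h; congr (_ < - deg (L _ _))%E; apply/val_inj; rewrite /= inordK.
have recr (g : 'cV_m.+2) (j : 'I_n.+1) :
    \sum_(i < m.+2) L j (inord i) * (g i ord0)%:L =
    \sum_(i < m.+1) L j (inord i) * (g (widen_ord (leqnSn m.+1) i) ord0)%:L
      + L j (inord m.+1) * (g ord_max ord0)%:L.
  by rewrite big_ord_recr.
rewrite /= {}IHm ?(ltnW lt_m) //; apply/seteqP; split=> g /=.
  case=> Hg /step Hm j; rewrite recr.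
  case: (unliftP ord_max j) => [j'|] ->.
    have -> : lift ord_max j' = j' :> nat by apply: lift_max.
    (* An earlier row has a zero in the new column, so its condition is unchanged. *)
    rewrite [L _ (inord m.+1)]trL; last by rewrite !inordK; have := ltn_ord j'; lia.
    rewrite mul0r addr0; have := Hg j'.
    by congr vanish_below; congr lcoef; apply: eq_bigr => i _; rewrite mxE.
  exact: Hm.
move=> Hg; split; last by apply/step; have := Hg ord_max; rewrite recr.
move=> j; have := Hg (widen_ord (leqnSn m.+1) j); rewrite recr.
rewrite [L _ (inord m.+1)]trL; last by rewrite !inordK /=; have := ltn_ord j; lia.
rewrite mul0r addr0.
by congr vanish_below; congr lcoef; apply: eq_bigr => i _; rewrite mxE.
Qed.

Lemma net_indexE n (L : 'M[K]_n.+1) :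
  is_trig_mx L -> (forall i, L i i != 0 /\ 0 <= lorder (L i i)) ->
  net_index L = ind_index L n.
Proof.
move=> trL dL; rewrite ind_indexE //.
have sE (g : 'cV_n.+1) (j : 'I_n.+1) :
    \sum_(i < n.+1) L (inord j) (inord i) * (g i ord0)%:L
    = (L *m vecL g) j ord0.
  by rewrite mxE; apply: eq_bigr => i _; rewrite !inord_val mxE.
apply/seteqP; split=> g /=; first by move=> /unit_boxP Hg j; rewrite sE.
by move=> Hg; apply/unit_boxP => j; rewrite -sE.
Qed.

End LaurentDegree.

(** * Cardinality through explicit enumeration *)

(** An injective enumeration passes directly to images and products over any type [U], with
    finiteness built in; [has_card_fset] converts it at the end. *)
Definition has_card (U : Type) (A : set U) (N : nat) : Prop :=
  exists (T : finType) (h : T -> U), [/\ injective h, A = range h & #|T| = N].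

Lemma has_card_image (U V : Type) (phi : U -> V) (A : set U) N :
  injective phi -> has_card A N -> has_card (phi @` A) N.
Proof.
move=> phi_inj [T [h [h_inj -> cT]]]; exists T, (phi \o h); split=> //.
  exact: inj_comp.
by rewrite image_comp.
Qed.

Lemma has_card_setX (U V : Type) (A : set U) (B : set V) M N :
  has_card A M -> has_card B N -> has_card (A `*` B) (M * N).
Proof.
move=> [T [h [h_inj -> cT]]] [T' [h' [h'_inj -> cT']]].
exists (T * T')%type, (fun x => (h x.1, h' x.2)).
split; last by rewrite card_prod cT cT'.
  by move=> [x x'] [y y'] /= [/h_inj -> /h'_inj ->].
apply/seteqP; split=> [[u v] [/= [x _ <-] [x' _ <-]]|_ [x _ <-]].
  by exists (x, x').
by split; [exists x.1 | exists x.2].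
Qed.

Lemma has_card_fset (U : choiceType) (A : set U) N :
  has_card A N -> finite_set A /\ #|` fset_set A| = N.
Proof.
move=> [T [h [h_inj -> cT]]].
have -> : range h = [set` [fset h x | x : T]%fset].
  apply/seteqP; split=> [_ [x _ <-]|u /imfsetP[x _ ->]]; last by exists x.
  exact: in_imfset.
by split; [exact: finite_fset|rewrite set_fsetK card_imfset // -cardE].
Qed.

(** * Counting the index sets *)

Section Counting.
Context {F : finFieldType}.
Local Notation K := (laurent F).

(** Here [- deg l] is the natural number [lorder l], and polynomials of smaller degree are the
    coefficient vectors of that length. *)
Lemma has_card_deg_lt (l : K) : l != 0 -> 0 <= lorder l ->
  has_card [set h : {poly F} | (deg h%:L < - deg l)%E] (#|F| ^ `|lorder l|).
Proof.
move=> l0 le_l; exists 'rV[F]_`|lorder l|, rVpoly; split.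
- exact: can_inj rVpolyK.
- have degE (h : {poly F}) : (deg h%:L < - deg l)%E <-> (size h <= `|lorder l|)%N.
    by rewrite (deg_neq0 l0) -EFinN opprK deg_lt -vanish_poly gez0_abs.
  apply/seteqP; split=> [h /degE le_h|_ [v _ <-]].
    by exists (poly_rV h); rewrite ?poly_rV_K.
  exact/degE/size_poly.
- by rewrite card_mx mul1n.
Qed.

(** Earlier coordinates only shift the range of the new one, without changing its size. So each set
    is an injective image of the preceding set times a set of polynomials of bounded degree. *)
Lemma has_card_ind_index n (L : 'M[K]_n.+1) m :
  (forall i, L i i != 0 /\ 0 <= lorder (L i i)) -> (m <= n)%N ->
  has_card (ind_index L m)
    (\prod_(j < m.+1) #|F| ^ `|lorder (L (inord j) (inord j))|).
Proof.
move=> dL; elim: m => [_|m IHm lt_m].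
  rewrite big_ord1 (_ : inord _ = ord0); last by apply/val_inj; rewrite /= inordK.
  have [l0 le_l] := dL ord0.
  pose phi (h : {poly F}) : 'cV_1 := const_mx h.
  rewrite (_ : ind_index _ _ = phi @` [set h | (deg h%:L < - deg (L ord0 ord0))%E]).
    apply: has_card_image; last exact: has_card_deg_lt.
    by move=> h h' /matrixP/(_ ord0 ord0); rewrite !mxE.
  apply/seteqP; split=> [g Hg|_ [h Hh <-]] /=; last by rewrite mxE.
  by exists (g ord0 ord0) => //; apply/matrixP => i j; rewrite !ord1 mxE.
rewrite big_ord_recr /=; have [l0 le_l] := dL (inord m.+1).
have {IHm} := has_card_setX (IHm (ltnW lt_m)) (has_card_deg_lt l0 le_l).
pose y (g : 'cV[{poly F}]_m.+1) := poly_part (- (L (inord m.+1) (inord m.+1))^-1 *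
  \sum_(i < m.+1) L (inord m.+1) (inord i) * (g i ord0)%:L).
pose phi (x : 'cV[{poly F}]_m.+1 * {poly F}) : 'cV[{poly F}]_m.+2 :=
  \col_i (if unlift ord_max i is Some j then x.1 j ord0 else y x.1 + x.2).
have widenE (i : 'I_m.+1) : widen_ord (leqnSn m.+1) i = lift ord_max i.
  exact/val_inj/esym/lift_max.
have phi_widen x i : phi x (widen_ord (leqnSn m.+1) i) ord0 = x.1 i ord0.
  by rewrite mxE widenE liftK.
have phi_max x : phi x ord_max ord0 = y x.1 + x.2.
  by rewrite mxE unlift_none.
have phi_inj : injective phi.
  move=> [g h] [g' h'] E.
  have Eg : g = g'.
    apply/colP => i.
    by rewrite -[LHS](phi_widen (g, h)) -[RHS](phi_widen (g', h')) E.
  (* Once the earlier coordinates agree, so do the shifts, and these cancel. *)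
  by have := phi_max (g, h); rewrite E phi_max Eg /= => /addrI ->.
move/(has_card_image phi_inj); congr has_card; apply/seteqP; split=> g.
  case=> -[g' h] [Hg' Hh] <- /=; split.
    rewrite (_ : \col_i _ = g') //.
    by apply/colP => i; rewrite mxE phi_widen.
  exists h => //; rewrite phi_max /y; congr (poly_part (_ * _) + _).
  by apply: eq_bigr => i _; rewrite phi_widen.
case=> Hg [h Hh gmax].
exists (\col_i g (widen_ord (leqnSn m.+1) i) ord0, h); first by split.
apply/colP => i; case: (unliftP ord_max i) => [j|] ->.
  by rewrite -widenE phi_widen mxE.
rewrite phi_max gmax /y; congr (poly_part (_ * _) + _).
by apply: eq_bigr => j _; rewrite mxE.
Qed.

End Counting.

Theorem theorem4p4 (b : nat) (b_prime : prime b) (n : nat)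
    (T L' Q : 'M[laurent 'F_b]_n.+1) (f : 'rV[{poly 'F_b}]_n.+1)
    (T_unit : T \in unitmx)
    (T_eq : T = L' *m Q)
    (L'_trig : is_trig_mx L')
    (Q_int : forall i j, (deg (Q i j) <= 0)%E)
    (Q_det : \det Q = 1)
    (f_neq0 : forall j, f ord0 j != 0)
    (f_deg : forall j : 'I_n.+1,
      (\big[maxe/-oo]_(i < n.+1 | (i <= j)%N) deg (L' j i)
         <= deg (f ord0 j)%:L)%E) :
  let P := net f T in
  let D := diag_mx (vecL f) in
  let L := invmx D *m L' in
  let S := net_index L in
  [/\ finite_set P,
      (#|` fset_set P|)%:R =
        b%:R ^ (- fine (deg (\det T)) + \sum_j fine (deg (f ord0 j)%:L)) :> rat,
      P = [set L *m Q *m vecL (map_mx (@poly_part _) (invmx Q *m vecL g))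
             | g in S] &
      S = ind_index L n].
Proof.
move=> P D L S.
have fL0 j : (f ord0 j)%:L != 0 by rewrite laurent_of_poly_eq0.
have LE i j : L i j = (f ord0 i)%:L^-1 * L' i j.
  by rewrite /L invmx_diag_vecL // mxE.
have vL : integral_mx L.
  (* Entries above the diagonal vanish. For the others [f_deg] bounds the degree of [L' i j] by that
     of [f ord0 i], so the quotient has degree at most 0. *)
  move=> i j; have [le_ji|lt_ij] := leqP j i; last first.
    by rewrite LE (is_trig_mxP L'_trig) // mulr0.
  rewrite LE mulrC; have fV0 : (f ord0 i)%:L^-1 != 0 by rewrite invr_eq0.
  rewrite -[0](addrNK (lorder (f ord0 i)%:L^-1)) vanish_mulr //.
  rewrite lorderV // sub0r opprK.
  have := f_deg i; rewrite (deg_neq0 (fL0 i)).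
  rewrite (bigD1 j) //= ge_max => /andP[/deg_le].
  by rewrite opprK.
have vQ : integral_mx Q by move=> i j; have /deg_le := Q_int i j; rewrite oppr0.
have uQ : Q \in unitmx by rewrite unitmxE Q_det unitr1.
have trL : is_trig_mx L.
  by apply/is_trig_mxP => i j lt_ij; rewrite LE (is_trig_mxP L'_trig) ?mulr0.
have dT : \det T = \prod_i L' i i by rewrite T_eq det_mulmx Q_det mulr1 det_trig.
have L'0 i : L' i i != 0.
  by move: T_unit; rewrite unitmxE unitfE dT => /prodf_neq0/(_ i isT).
have dL i : L i i != 0 /\ 0 <= lorder (L i i).
  have Li0 : L i i != 0 by rewrite LE mulf_neq0 ?invr_eq0.
  (* If the order were negative, [vL] would make the leading coefficient vanish. *)
  split=> //; have [Lw _] := lorderP Li0.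
  by rewrite leNgt; apply: contraNN Lw => /vL ->.
have uL : L \in unitmx.
  rewrite unitmxE unitfE det_trig //.
  by apply/prodf_neq0 => i _; have [] := dL i.
have PE : P = [set L *m Q *m vecL (map_mx (@poly_part _) (invmx Q *m vecL g))
             | g in S].
  by apply: net_image => //; rewrite T_eq mulmxA.
have SE : S = ind_index L n by apply: net_indexE.
have := has_card_ind_index dL (leqnn n); rewrite -SE.
move=> /(has_card_image (net_image_inj uL uQ vQ)); rewrite -PE.
move=> /has_card_fset[finP cardP]; split=> //; rewrite {}cardP card_Fp //.
(* Degrees are negated orders and [\det T] is the product of the diagonal of [L'], so both sides sum
   the order of [L' j j] minus that of [f ord0 j]; by [dL] the absolute values change nothing. *)
have -> : - fine (deg (\det T)) + \sum_j fine (deg (f ord0 j)%:L)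
    = \sum_j (`|lorder (L j j)|%N)%:Z.
  rewrite dT deg_neq0 /=; last by apply/prodf_neq0.
  rewrite opprK lorder_prod // -big_split; apply: eq_bigr => j _ /=.
  have [_ /gez0_abs ->] := dL j.
  by rewrite LE lorderM ?invr_eq0 // lorderV // (deg_neq0 (fL0 j)) addrC.
(* The exponent is now a sum of naturals, so the rational power is the cast of a natural power. *)
rewrite -(big_morph Posz PoszD (erefl _)) -exprnP -natrX expn_sum; congr _%:R.
by apply: eq_bigr => j _; rewrite inord_val.
Qed.
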